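(* Let $K$ be a field. For every $n\ge1$ and every integer $r$ with $1\le r\le 2^{2n}$, one can modify at most $2^{2n}/r$ entries of $H_n$ and obtain a matrix of rank (over $K$) at most $(n/\ln r)^{O(\sqrt{n\log r})}$, where the constant implied by the $O(\cdot)$ is absolute.
   Context: For $n\ge 1$, the Walsh–Hadamard matrix $H_n$ is the $2^n\times 2^n$ matrix whose rows and columns are indexed by the vectors of $\{0,1\}^n$ with $H_n(u,v)=(-1)^{\langle u,v\rangle}$, where $\langle u,v\rangle=\sum_{k=1}^n u_k v_k$, viewed as a matrix with entries $\pm1$ in $K$.
   Formalization: The base n/ln r is read as max(2, n/ln r), because the literal bound fails when ln r is near or above n (e.g. r = floor(e^n), n large, char K not 2); for r = 1, where n/ln r is undefined, the bound is read as 1. *)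

(* Defs.v *)
From HB Require Import structures.
From mathcomp Require Import all_boot all_order all_algebra.
From mathcomp Require Import all_classical all_reals all_analysis.

Set Implicit Arguments.
Unset Strict Implicit.
Unset Printing Implicit Defensive.

Import Order.TTheory GRing.Theory Num.Theory.

Local Open Scope ring_scope.

Definition cube (n : nat) : finType := {ffun 'I_n -> bool}.

Lemma card_cube (n : nat) : #|cube n| = (2 ^ n)%N.
Proof. by rewrite card_ffun card_bool card_ord. Qed.

Definition dotn (n : nat) (u v : cube n) : nat := (\sum_(k < n) u k * v k)%N.

(* The rows and columns are numbered by the canonical enumeration of the cube,
   hence the dimension #|cube n|, which is 2 ^ n by card_cube. *)
Definition walsh_hadamard (K : fieldType) (n : nat) : 'M[K]_#|cube n| :=
  \matrix_(i, j) (-1) ^+ dotn (enum_val i) (enum_val j).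

Definition num_modified (T : eqType) (m p : nat) (A B : 'M[T]_(m, p)) : nat :=
  #|[set ij : 'I_m * 'I_p | A ij.1 ij.2 != B ij.1 ij.2]%SET|.

(* The bound (n / ln r) ^ (C * sqrt (n ln r)), the base being floored at 2.
   Without a floor greater than 1 the bound tends to 1 as ln r approaches n and
   drops below 1 beyond (r <= 2 ^ (2 n) allows n / ln r < 1).  Any other floor
   greater than 1 only changes the constant C.  For r = 1 the value is 1. *)
Definition rank_bound (R : realType) (C : R) (n r : nat) : R :=
  Num.max 2 (n%:R / ln r%:R) `^ (C * Num.sqrt (n%:R * ln r%:R)).

(* Main.v *)
Require Import Defs.
From mathcomp Require Import all_boot all_order all_algebra.
From mathcomp Require Import all_classical all_reals all_analysis.
From mathcomp Require Import ring lra.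

Set Implicit Arguments.
Unset Strict Implicit.
Unset Printing Implicit Defensive.

Import Order.TTheory GRing.Theory Num.Theory.

Local Open Scope ring_scope.

(** For uniform [(u, v)] the number [<u, v>] is binomial with parameters [n] and
    [1/4], so outside a fraction [1/r] of the entries it lies in a window of
    length [L = O(sqrt (n ln r))] around [n/4].  Binomial coefficients
    interpolate [(-1) ^ x] on any such window by an integral combination of
    [C(x, 0), ..., C(x, L)], and the matrix of the [C(<u, v>, k)] has rank at
    most [C(n, k)] over every field.  With [d = sqrt (ln r / n) <= 1], the sum
    of these ranks is at most [d ^ (- L) * (1 + d) ^ n].  If instead [n < ln r],
    then [2 ^ n <= 2 ^ sqrt (n ln r)] and [H_n] itself will do. *)

(** * Interpolation of signs by binomial coefficients *)

Lemma binomial_sum_unshift1 (K : comPzRingType) (L : nat) (c : nat -> K) :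
  exists d : nat -> K, forall x : nat,
    \sum_(i < L) c i * 'C(x, i)%:R = \sum_(i < L) d i * 'C(x.+1, i)%:R.
Proof.
elim: L c => [|L IHL] c; first by exists c => x; rewrite !big_ord0.
case: L IHL => [|L] IHL.
  by exists c => x; rewrite !big_ord1 !bin0.
(* By Pascal's rule [C(x, L+1) = C(x+1, L+1) - C(x, L)]: the top coefficient is kept, and its
   opposite is added to the coefficient of index [L]. *)
have [d dP] := IHL (fun i => if i == L then c i - c L.+1 else c i).
exists (fun i => if i == L.+1 then c L.+1 else d i) => x.
rewrite [RHS]big_ord_recr /= eqxx.
under [X in _ = X + _]eq_bigr => i _ do rewrite ltn_eqF ?ltn_ord //.
rewrite -dP !big_ord_recr /= eqxx.
under [X in _ = X + _ + _]eq_bigr => i _ do rewrite ltn_eqF ?ltn_ord //.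
by rewrite binS natrD; ring.
Qed.

Lemma binomial_sum_unshift (K : comPzRingType) (L a : nat) (c : nat -> K) :
  exists d : nat -> K, forall x : nat,
    \sum_(i < L) c i * 'C(x, i)%:R = \sum_(i < L) d i * 'C(a + x, i)%:R.
Proof.
elim: a => [|a [d dP]]; first by exists c.
have [e eP] := binomial_sum_unshift1 L d.
by exists e => x; rewrite dP eP addSn.
Qed.

Lemma sign_binomial_sum (K : comPzRingType) (L x : nat) : (x <= L)%N ->
  (-1) ^+ x = \sum_(i < L.+1) (-2) ^+ i * 'C(x, i)%:R :> K.
Proof.
move=> xL; have -> : -1 = 1 + (-2) :> K by ring.
rewrite exprDn (big_ord_widen L.+1 (fun i => 1 ^+ (x - i) * (-2) ^+ i *+ 'C(x, i))) //.
rewrite big_mkcond /=; apply: eq_bigr => i _.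
rewrite expr1n mul1r mulr_natr; case: ltnP => // xi.
by rewrite bin_small.
Qed.

(** Expand [(1 - 2) ^ (x - a)] and shift the argument back by [a]. Nothing is divided, so this works
    in every characteristic. *)
Lemma sign_interpolation (K : comPzRingType) (a L : nat) :
  exists c : nat -> K, forall x : nat, (a <= x <= a + L)%N ->
    (-1) ^+ x = \sum_(i < L.+1) c i * 'C(x, i)%:R.
Proof.
have [d dP] := binomial_sum_unshift L.+1 a (fun i => (-1) ^+ a * (-2 : K) ^+ i).
exists d => x /andP[ax xL]; rewrite -(subnKC ax) -dP exprD.
rewrite (@sign_binomial_sum _ L (x - a)) ?leq_subLR // mulr_sumr.
by apply: eq_bigr => i _; rewrite mulrA.
Qed.

(** * Ranks of matrices of binomial coefficients *)

Lemma dotn_card (n : nat) (u v : cube n) :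
  dotn u v = #|[set k | u k && v k]%SET|.
Proof.
rewrite /dotn -sum1_card [RHS]big_mkcond /=.
by apply: eq_bigr => k _; rewrite inE; case: (u k); case: (v k).
Qed.

(* [C(<u,v>, k)] counts the [k]-sets contained in both supports, so the matrix
   factors through the [C(n, k)] sets of size [k]. *)
Lemma rank_binomial_dotn (K : fieldType) (n k : nat) :
  (\rank (\matrix_(i, j) 'C(dotn (enum_val i) (enum_val j), k)%:R :
     'M[K]_#|cube n|) <= 'C(n, k))%N.
Proof.
pose D := [set S : {set 'I_n} | #|S| == k]%SET.
pose A : 'M[K]_(#|cube n|, #|D|) :=
  \matrix_(i, s) ((enum_val s : {set 'I_n}) \subset [set l | (enum_val i : cube n) l]%SET)%:R.
have -> : \matrix_(i, j) 'C(dotn (enum_val i) (enum_val j), k)%:R = A *m A^T.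
  apply/matrixP => i j; rewrite !mxE.
  set u := enum_val i; set v := enum_val j.
  pose su := [set l | (u : cube n) l]%SET; pose sv := [set l | (v : cube n) l]%SET.
  under eq_bigr => s _ do rewrite !mxE -natrM mulnb.
  rewrite -(big_enum_val (A := mem D)
    (fun S : {set 'I_n} => ((S \subset su) && (S \subset sv))%:R)).
  rewrite -natr_sum; congr (_%:R).
  rewrite dotn_card -cards_draws -sum1_card big_mkcond [RHS]big_mkcond /=.
  apply: eq_bigr => S _; rewrite !inE -finset.subsetI.
  have -> : [set l | u l && v l]%SET = (su :&: sv)%SET.
    by apply/setP => l; rewrite !inE.
  by rewrite andbC; case: (#|S| == k); case: (S \subset _).
apply: leq_trans (mxrankM_maxl _ _) _; apply: leq_trans (rank_leq_col _) _.
by rewrite card_draws card_ord.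
Qed.

Lemma rank_binomial_sum (K : fieldType) (n L : nat) (c : nat -> K) :
  (\rank (\matrix_(i, j)
     (\sum_(k < L) c k * 'C(dotn (enum_val i) (enum_val j), k)%:R)%R :
     'M[K]_#|cube n|) <= \sum_(k < L) 'C(n, k))%N.
Proof.
have -> : (\matrix_(i, j)
     \sum_(k < L) c k * 'C(dotn (enum_val i) (enum_val j), k)%:R :
     'M[K]_#|cube n|) =
   \sum_(k < L) c k *: \matrix_(i, j) 'C(dotn (enum_val i) (enum_val j), k)%:R.
  apply/matrixP => i j; rewrite summxE mxE.
  by apply: eq_bigr => k _; rewrite !mxE.
apply: (big_ind2 (fun (M : 'M[K]_#|cube n|) b => \rank M <= b)%N).
- by rewrite mxrank0.
- by move=> M1 b1 M2 b2 h1 h2; apply: leq_trans (mxrank_add _ _) (leq_add h1 h2).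
- by move=> k _; apply: leq_trans (mxrank_scale _ _) (rank_binomial_dotn _ _ _).
Qed.

Lemma binomial_sum_le (R : realDomainType) (n L : nat) (x : R) : 0 <= x ->
  \sum_(k < L) 'C(n, k)%:R * x ^+ k <= (1 + x) ^+ n.
Proof.
move=> x0; elim: n L => [|n IHn] [|L].
- by rewrite big_ord0 expr0.
- rewrite big_ord_recl bin0 !expr0 mulr1 big1 ?addr0 // => k _.
  by rewrite bin0n mul0r.
- by rewrite big_ord0 exprn_ge0 ?addr_ge0.
rewrite big_ord_recl bin0 expr0 mulr1.
under eq_bigr => k _.
  have -> : 'C(n.+1, lift ord0 k)%:R * x ^+ (lift ord0 k) =
    'C(n, k.+1)%:R * x ^+ k.+1 + x * ('C(n, k)%:R * x ^+ k).
    by rewrite /= /bump add1n binS natrD exprS; ring.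
  over.
rewrite big_split /= -mulr_sumr addrA exprS mulrDl mul1r.
apply: lerD; last by rewrite ler_wpM2l ?IHn.
by have := IHn L.+1; rewrite big_ord_recl bin0 expr0 mulr1.
Qed.

(** * Exponential moments and tails of the inner product *)

Lemma sum_expr_dotn (K : comPzRingType) (n : nat) (z : K) :
  \sum_(u : cube n) \sum_(v : cube n) z ^+ dotn u v = (3 + z) ^+ n.
Proof.
under eq_bigr => u _.
  under eq_bigr => v _ do rewrite /dotn expr_sum.
  rewrite -(bigA_distr_bigA (fun k (b : bool) => z ^+ (u k * b))).
  over.
rewrite -(bigA_distr_bigA (fun k (a : bool) => \sum_(b : bool) z ^+ (a * b))).
(* The sum now factors over coordinates. Of the four bit pairs at a coordinate, three contribute 1
   and the pair (1, 1) contributes [z]. *)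
under eq_bigr => k _ do rewrite !big_bool /= !expr0 expr1.
by rewrite prodr_const card_ord; congr (_ ^+ _); ring.
Qed.

(** Inverting [1 - y <= exp (- y)] bounds [exp y] by [1 / (1 - y)]; the rest is polynomial. *)
Lemma expR_le_quadratic (R : realType) (y : R) :
  `|y| <= 2^-1 -> expR y <= 1 + y + 2 * y ^+ 2.
Proof.
rewrite ler_norml => /andP[y1 y2].
have h : 0 < 1 - y by lra.
have h1 : 1 - y <= expR (- y) := expR_ge1Dx (- y).
rewrite -[y in expR y]opprK expRN.
apply: (@le_trans _ _ (1 - y)^-1); first by rewrite lef_pV2 ?posrE ?expR_gt0.
rewrite -div1r ler_pdivrMr // -subr_ge0.
have -> : (1 + y + 2 * y ^+ 2) * (1 - y) - 1 = y ^+ 2 * (1 - 2 * y) by ring.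
by rewrite mulr_ge0 ?sqr_ge0 //; lra.
Qed.

(** This is the moment generating function of a centred Bernoulli(1/4) variable, times 4. Centring
    cancels the linear terms, and the quadratic ones add up to [3/2 s^2 <= 4 s^2]. *)
Lemma expR_bernoulli_quarter_le (R : realType) (s : R) : `|s| <= 2^-1 ->
  3 * expR (- (s / 4)) + expR (3 / 4 * s) <= 4 * expR (s ^+ 2).
Proof.
rewrite ler_norml => /andP[s1 s2].
have h1 : expR (- (s / 4)) <= 1 + - (s / 4) + 2 * (- (s / 4)) ^+ 2.
  by apply: expR_le_quadratic; rewrite ler_norml; apply/andP; split; lra.
have h2 : expR (3 / 4 * s) <= 1 + 3 / 4 * s + 2 * (3 / 4 * s) ^+ 2.
  by apply: expR_le_quadratic; rewrite ler_norml; apply/andP; split; lra.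
have h3 := expR_ge1Dx (s ^+ 2); have h4 := sqr_ge0 s.
have e1 : (- (s / 4)) ^+ 2 = s ^+ 2 / 16 by field.
have e2 : (3 / 4 * s) ^+ 2 = 9 * s ^+ 2 / 16 by field.
by rewrite e1 in h1; rewrite e2 in h2; lra.
Qed.

Lemma sum_expR_dotn_le (R : realType) (n : nat) (s : R) : `|s| <= 2^-1 ->
  \sum_(u : cube n) \sum_(v : cube n) expR (s * ((dotn u v)%:R - n%:R / 4)) <=
  4 ^+ n * expR (n%:R * s ^+ 2).
Proof.
move=> hs.
under eq_bigr => u _.
  under eq_bigr => v _.
    have -> : s * ((dotn u v)%:R - n%:R / 4) =
      n%:R * (- (s / 4)) + (dotn u v)%:R * s by ring.
    rewrite expRD !expRM_natl.
    over.
  rewrite -mulr_sumr.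
  over.
rewrite -mulr_sumr sum_expr_dotn -exprMn expRM_natl -exprMn.
rewrite lerXn2r ?nnegrE ?mulr_ge0 ?addr_ge0 ?expR_ge0 //.
apply: le_trans (expR_bernoulli_quarter_le hs).
rewrite mulrDr -expRD mulrC; apply: lerD => //.
by rewrite ler_expR; lra.
Qed.

Lemma sum_enum_val (V : nmodType) (T : finType) (F : T -> V) :
  \sum_(i < #|T|) F (enum_val i) = \sum_x F x.
Proof. by rewrite -big_enum_val. Qed.

(** Markov's inequality in counting form: the indicator of [t <= |X|] is at most
    [exp (- s t) (exp (s X) + exp (- s X))], one summand for each tail. *)
Lemma chernoff_dotn (R : realType) (n : nat) (s t : R) : 0 <= s <= 2^-1 ->
  #|[set ij : 'I_#|cube n| * 'I_#|cube n| |
     t <= `|(dotn (enum_val ij.1) (enum_val ij.2))%:R - n%:R / 4| ]%SET|%:R <=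
  2 * 4 ^+ n * expR (n%:R * s ^+ 2 - s * t).
Proof.
move=> /andP[s0 s1].
pose X (u v : cube n) : R := (dotn u v)%:R - n%:R / 4.
pose F (u v : cube n) := expR (- (s * t)) * (expR (s * X u v) + expR (- s * X u v)).
apply: (@le_trans _ _ (\sum_(ij : 'I_#|cube n| * 'I_#|cube n|)
   F (enum_val ij.1) (enum_val ij.2))).
  rewrite -sum1_card natr_sum big_mkcond /=; apply: ler_sum => ij _.
  rewrite inE -/(X _ _) /F; set x := X _ _.
  case: ifPn => [tx|_]; last by rewrite mulr_ge0 ?addr_ge0 ?expR_ge0.
  rewrite mulrDr -!expRD.
  case: (ger0P x) tx => [x0|x0] tx.
    apply: ler_wpDr; rewrite ?expR_ge0 // -expR0 ler_expR.
    by rewrite addrC subr_ge0 ler_wpM2l.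
  apply: ler_wpDl; rewrite ?expR_ge0 // -expR0 ler_expR.
  by rewrite addrC subr_ge0 mulNr -mulrN ler_wpM2l.
rewrite -(pair_bigA _ (fun i j => F (enum_val i) (enum_val j))) /=.
under eq_bigr => i _ do rewrite sum_enum_val.
rewrite (sum_enum_val (fun u => \sum_v F u v)) /F.
under eq_bigr => u _ do rewrite -mulr_sumr big_split.
rewrite -mulr_sumr big_split /=.
have h1 := @sum_expR_dotn_le R n s; have h2 := @sum_expR_dotn_le R n (- s).
rewrite normrN sqrrN ger0_norm // in h1 h2.
rewrite [in leRHS]addrC expRD [leRHS]mulrCA ler_wpM2l ?expR_ge0 //.
by move: (h1 s1) (h2 s1); rewrite /X; lra.
Qed.

(** * Estimates for the window, the logarithm and the sum of ranks *)

Lemma interval_window (R : realType) (c t : R) : 0 <= t ->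
  exists a L : nat, L%:R <= 2 * t + 1 /\
    forall x : nat, `|x%:R - c| < t -> (a <= x <= a + L)%N.
Proof.
(* [Num.truncn] is 0 on negative reals, so the window starts at 0 when [c < t]. Rounding its start
   down costs less than 1 in length. *)
move=> t0; exists (Num.truncn (c - t)), (Num.truncn (2 * t + 1)).
split=> [|x]; first by rewrite truncn_le; lra.
rewrite ltr_norml => /andP[x1 x2]; apply/andP; split.
  by rewrite truncn_le_nat -natr1; lra.
rewrite -leq_subLR truncn_ge_nat; last by lra.
have h := truncnS_gt (c - t); rewrite -natr1 in h.
case: (leqP (Num.truncn (c - t)) x) => [ax|xa]; first by rewrite natrB //; lra.
have -> : (x - Num.truncn (c - t) = 0)%N by apply/eqP; rewrite subn_eq0 ltnW.
by rewrite mulr0n; lra.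
Qed.

Lemma ln2_ge_half (R : realType) : 2^-1 <= ln 2 :> R.
Proof.
rewrite -ler_expR lnK ?posrE //.
have h : 2^-1 <= expR (- 2^-1) :> R by apply: le_trans (expR_ge1Dx _); lra.
by rewrite -[X in expR X]opprK expRN invf_ple ?posrE ?expR_gt0.
Qed.

(** As [x <= 1], each [x ^ k] with [k <= L] is at least [x ^ L]; hence [x ^ L] times the sum is at
    most [(1 + x) ^ n <= exp (n x)]. *)
Lemma binomial_sum_le_expR (R : realType) (n L : nat) (x : R) : 0 < x <= 1 ->
  \sum_(k < L.+1) 'C(n, k)%:R <= expR (n%:R * x - L%:R * ln x).
Proof.
move=> /andP[x0 x1].
rewrite expRD expRN !expRM_natl lnK ?posrE // ler_pdivlMr ?exprn_gt0 //.
apply: (@le_trans _ _ ((1 + x) ^+ n)); last first.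
  by rewrite lerXn2r ?nnegrE ?expR_ge0 ?expR_ge1Dx // addr_ge0 // ltW.
apply: le_trans (binomial_sum_le n L.+1 (ltW x0)).
rewrite mulr_suml; apply: ler_sum => k _; rewrite ler_wpM2l //.
by apply: ler_wiXn2l; rewrite ?(ltW x0) // -ltnS.
Qed.

Lemma rank_bound_1 (R : realType) (C : R) (n : nat) : rank_bound C n 1 = 1.
Proof. by rewrite /rank_bound ln1 mulr0 sqrtr0 mulr0 powRr0. Qed.

Theorem theorem1p2 (R : realType) :
  exists2 C : R, 0 < C &
    forall (K : fieldType) (n r : nat),
      (1 <= n)%N -> (1 <= r <= 2 ^ (2 * n))%N ->
      exists M : 'M[K]_#|cube n|,
        (num_modified (walsh_hadamard K n) M)%:R <= 2 ^+ (2 * n) / r%:R :> R /\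
        (\rank M)%:R <= rank_bound C n r.
Proof.
(* The final exponent is at most [q + 7 q ln b], and [q <= 2 q ln b] because [ln b >= 1/2]. *)
exists 9 => // K n r n1 /andP[r1 _].
have [->|r2] : r = 1%N \/ (2 <= r)%N.
  by case: r r1 => [|[|r]] // _; [left|right].
  (* For [r = 1] every entry may be modified. *)
  exists 0; rewrite mxrank0 rank_bound_1 ler01 divr1; split=> //.
  rewrite /num_modified -natrX ler_nat; apply: leq_trans (max_card _) _.
  by rewrite card_prod card_ord card_cube -expnD mul2n addnn.
set lr := ln r%:R : R.
have lr2 : 2^-1 <= lr.
  by apply: le_trans (ln2_ge_half R) _; rewrite ler_ln ?posrE ?ler_nat // ltr0n.
have lr0 : 0 < lr by lra.
have nR : 1 <= n%:R :> R by rewrite ler1n.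
have n0 : 0 < n%:R :> R by lra.
set q := Num.sqrt (n%:R * lr).
have q2 : q ^+ 2 = n%:R * lr by rewrite sqr_sqrtr // mulr_ge0 // ltW.
have q0 : 0 <= q by rewrite sqrtr_ge0.
have q12 : 2^-1 <= q.
  rewrite -(ler_pXn2r (n := 2)) ?nnegrE // q2.
  by have := ler_pM _ _ nR lr2; lra.
set b := Num.max 2 (n%:R / lr).
have b2 : 2 <= b by rewrite le_max lexx.
have b0 : 0 < b by lra.
have lb2 : 2^-1 <= ln b.
  by apply: le_trans (ln2_ge_half R) _; rewrite ler_ln ?posrE.
have -> : rank_bound 9 n r = expR (9 * q * ln b).
  by rewrite /rank_bound -/lr -/q -/b /powR gt_eqF.
case: (lerP lr n%:R) => [lrn|nlr]; last first.
  exists (walsh_hadamard K n); split.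
    rewrite /num_modified; set S := [set _ | _]%SET.
    have -> : S = finset.set0 by apply/setP => ij; rewrite !inE eqxx.
    by rewrite cards0 divr_ge0 // exprn_ge0.
  apply: (@le_trans _ _ (2 ^+ n)).
    by rewrite -natrX ler_nat -card_cube rank_leq_row.
  have nq : n%:R <= q.
    by rewrite -(ler_pXn2r (n := 2)) ?nnegrE // q2 expr2 ler_wpM2l // ltW.
  rewrite -[X in X ^+ n]lnK ?posrE // -expRM_natl ler_expR.
  have : ln 2 <= ln b by rewrite ler_ln ?posrE.
  have := ln2_ge_half R; set l2 := ln 2; nra.
(* One parameter serves both estimates: the rank bound uses [d], with [n d = q], and the tail bound
   uses [d / 2], with [q d = ln r]. *)
pose d := q / n%:R.
have d0 : 0 < d by rewrite divr_gt0 //; lra.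
have nd : n%:R * d = q by rewrite /d; field; rewrite gt_eqF.
have qd : q * d = lr.
  by rewrite /d mulrA -expr2 q2; field; rewrite gt_eqF.
have d1 : d <= 1.
  rewrite ler_pdivrMr // mul1r -(ler_pXn2r (n := 2)) ?nnegrE // q2 expr2.
  by rewrite ler_wpM2l // ltW.
(* With [s = d / 2] and [t = 5 q] the Chernoff exponent is [(1/4 - 5/2) ln r <= - 2 ln r]. The
   resulting fraction [2 / r^2] is at most [1 / r] since [r >= 2]. *)
have t0 : 0 <= 5 * q by lra.
have [a [L [hL window]]] := interval_window (n%:R / 4) t0.
have [c cP] := sign_interpolation K a L.
exists (\matrix_(i, j)
  \sum_(k < L.+1) c k * 'C(dotn (enum_val i) (enum_val j), k)%:R); split.
  have hd : 0 <= d / 2 <= 2^-1 by apply/andP; split; lra.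
  apply: le_trans (le_trans (chernoff_dotn n (5 * q) hd) _).
    (* Inside the window the interpolant equals the sign, so a modified entry lies in the tail. *)
    rewrite ler_nat; apply: subset_leq_card; apply/fintype.subsetP => ij.
    rewrite !inE !mxE leNgt; apply: contraNN => /window /cP ->.
    exact: eqxx.
  have -> : n%:R * (d / 2) ^+ 2 - d / 2 * (5 * q) = - (9 / 4 * lr).
    have -> : n%:R * (d / 2) ^+ 2 = (n%:R * d) * d / 4 by field.
    by rewrite nd -qd; field.
  have r0 : 0 < r%:R :> R by rewrite ltr0n.
  have -> : 2 ^+ (2 * n) = 4 ^+ n :> R by rewrite exprM; congr (_ ^+ _); ring.
  rewrite mulrAC mulrC ler_wpM2l ?exprn_ge0 //.
  apply: (@le_trans _ _ (2 * expR (- (2 * lr)))).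
    by rewrite ler_wpM2l // ler_expR; lra.
  rewrite expRN expRM_natl lnK ?posrE // expr2 invfM mulrA ler_piMl ?invr_ge0 ?(ltW r0) //.
  by rewrite ler_pdivrMr // mul1r ler_nat.
apply: (@le_trans _ _ (expR (n%:R * d - L%:R * ln d))).
  apply: le_trans (binomial_sum_le_expR n L _); last by rewrite d0.
  by rewrite -natr_sum ler_nat rank_binomial_sum.
rewrite ler_expR nd.
(* The base [b] is at least [n / ln r = d ^ (-2)]. *)
have db : - (2 * ln d) <= ln b.
  have -> : - (2 * ln d) = ln (n%:R / lr).
    have -> : n%:R / lr = (d ^+ 2)^-1.
      by rewrite -qd /d; field; rewrite !gt_eqF //; lra.
    by rewrite lnV ?posrE ?exprn_gt0 // lnXn // mulr_natl.
  by rewrite ler_ln ?posrE ?divr_gt0 // le_max lexx orbT.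
have : L%:R * (- (2 * ln d)) <= L%:R * ln b by rewrite ler_wpM2l.
(* Here [L <= 10 q + 1 <= 12 q], as [q >= 1/2]; the factor 14 leaves some slack. *)
have : L%:R * ln b <= (14 * q) * ln b by rewrite ler_wpM2r; lra.
have : q * 2^-1 <= q * ln b by rewrite ler_wpM2l.
lra.
Qed.
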